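(* Let $G$ be a concordance inducing distribution function, let $P\in\mathcal{P}_d^{\mathrm{B}}(1/2)$ and let a representation $P=\sum_{l=1}^{2^{d-1}}\alpha_l\,\rho(\pi_l)$ with $\alpha_1,\dots,\alpha_{2^{d-1}}\ge0$, $\alpha_1+\cdots+\alpha_{2^{d-1}}=1$ be given. Let $\boldsymbol{B}=(B_1,\dots,B_d)$ be the random vector obtained by choosing an index $l\in\{1,\dots,2^{d-1}\}$ with probability $\alpha_l$ and then setting $\boldsymbol{B}=\boldsymbol{b}(l)$ or $\boldsymbol{B}=\boldsymbol{1}-\boldsymbol{b}(l)$ with probability $1/2$ each, and let $U\sim\mathrm{U}(0,1)$ be independent of $\boldsymbol{B}$. Then $P$ is $\kappa_G$-attainable by $\boldsymbol{X}=(X_1,\dots,X_d)$ defined by $$X_j=B_jU+(1-B_j)(1-U),\quad j=1,\dots,d,$$ that is, $\kappa_G(X_i,X_j)=P_{ij}$ for all $i,j\in\{1,\dots,d\}$.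
   Context: A distribution function $G$ on $\mathbb{R}$ is concordance inducing if it belongs to a non-degenerate, symmetric (about some point) distribution with finite second moment; $G^{-1}(p)=\inf\{x:G(x)\ge p\}$. For $(X_1,X_2)$ with continuous margins $F_1,F_2$, $\kappa_G(X_1,X_2)=\rho(G^{-1}(F_1(X_1)),G^{-1}(F_2(X_2)))$ with $\rho$ Pearson's correlation. $\mathcal{P}^{\mathrm{B}}_d(1/2)$ is the set of correlation matrices of $d$-dimensional random vectors with all margins $\mathrm{Bern}(1/2)$. For $l=1,\dots,2^{d-1}$, $\boldsymbol{b}(l)=(b_1,\dots,b_d)\in\{0,1\}^d$ is the binary vector with $l=1+\sum_{j=1}^d b_j2^{d-j}$; $\pi_l$ is the distribution putting mass $1/2$ on each of $\boldsymbol{b}(l)$ and $\boldsymbol{1}-\boldsymbol{b}(l)$; and $\rho(\pi_l)$ is the correlation matrix of $\pi_l$, with $(i,j)$ entry $2\cdot\mathbf{1}_{\{b_i(l)=b_j(l)\}}-1$. *)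

(* Defs.v *)
From HB Require Import structures.
From mathcomp Require Import all_boot all_order all_algebra.
From mathcomp Require Import all_classical all_reals all_analysis.
From mathcomp Require Import measurable_realfun ring.
Set Implicit Arguments.
Unset Strict Implicit.
Unset Printing Implicit Defensive.
Import Order.TTheory GRing.Theory Num.Theory.
Import numFieldNormedType.Exports.
Local Open Scope classical_set_scope.
Local Open Scope ring_scope.

(* For [p] outside (0, 1) the set may be empty or unbounded below and [inf] is
   then [0]; below, [p] is the value of a continuous distribution function at
   its own random variable, which lies in (0, 1) almost surely. *)
Definition quantile (R : realType) (G : R -> R) (p : R) : R :=
  inf [set x | p <= G x].

(* [Q] is the law whose distribution function is [G]; symmetry about [c] says
   that [Y - c] and [c - Y] have the same law for [Y] distributed as [Q]. *)
Definition concordance_inducing (R : realType) (G : R -> R) : Prop :=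
  exists Q : probability (measurableTypeR R) R,
    [/\ forall x, Q [set` `]-oo, x]] = (G x)%:E,
        ~ (exists a, Q [set a] = 1%E),
        exists c, forall A : set (measurableTypeR R), measurable A ->
          Q ((fun y => y - c) @^-1` A) = Q ((fun y => c - y) @^-1` A)
      & (\int[Q]_y (y ^+ 2)%:E < +oo)%E].

Section correlation.
Context (R : realType) (disp : measure_display) (T : measurableType disp)
  (Pr : probability T R).

Definition pearson (X Y : T -> R) : R :=
  fine (covariance Pr X Y)
    / Num.sqrt (fine (variance Pr X) * fine (variance Pr Y)).

Definition corr_mx (d : nat) (X : 'I_d -> T -> R) : 'M[R]_d :=
  \matrix_(i, j) pearson (X i) (X j).

Definition dist_fun (X : {RV Pr >-> R}) (x : R) : R := fine (cdf X x).

Definition kappa (G : R -> R) (X Y : {RV Pr >-> R}) : R :=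
  pearson (fun w => quantile G (dist_fun X (X w)))
          (fun w => quantile G (dist_fun Y (Y w))).

(* Continuity of the margins is what makes the coefficients meaningful. No junk
   value of [fine] or of [/ 0] can satisfy the equations when [P i i = 1]: the
   diagonal ones force each variance to be finite and positive. *)
Definition kappa_attained_by (G : R -> R) (d : nat) (P : 'M[R]_d)
    (X : 'I_d -> {RV Pr >-> R}) : Prop :=
  (forall j, continuous (dist_fun (X j))) /\
  (forall i j, kappa G (X i) (X j) = P i j).

Definition independent_RV (d1 d2 : measure_display) (T1 : measurableType d1)
    (T2 : measurableType d2) (X : {RV Pr >-> T1}) (Y : {RV Pr >-> T2}) : Prop :=
  forall A1 A2, measurable A1 -> measurable A2 ->
    Pr (X @^-1` A1 `&` Y @^-1` A2) = (Pr (X @^-1` A1) * Pr (Y @^-1` A2))%E.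

Definition uniform01 (U : {RV Pr >-> R}) : Prop :=
  forall A, measurable A -> distribution Pr U A = uniform_prob (@ltr01 R) A.

End correlation.

Definition bit (R : realType) (d : nat) (j : 'I_d) (v : d.-tuple bool) : R :=
  (tnth v j)%:R.

Definition bern_half_corr (R : realType) (d : nat) : set 'M[R]_d :=
  [set P | exists (disp : measure_display) (T : measurableType disp)
             (Pr : probability T R) (B : {RV Pr >-> d.-tuple bool}),
     (forall j (A : set bool),
        Pr ((fun w => tnth (B w) j) @^-1` A) = bernoulli_prob (2^-1 : R) A) /\
     P = corr_mx Pr (fun j w => bit R j (B w))].

(* Indices are shifted by one: [l] in ['I_(2 ^ d.-1)] is the [l.+1]-st vector,
   and coordinate [j], counted from [0], has binary weight [2 ^ (d.-1 - j)];
   see [bvecE]. *)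
Definition bvec (d : nat) (l : 'I_(2 ^ d.-1)) : d.-tuple bool :=
  [tuple odd (l %/ 2 ^ (d.-1 - j)) | j < d].

Definition bvecC (d : nat) (l : 'I_(2 ^ d.-1)) : d.-tuple bool :=
  [tuple ~~ tnth (bvec l) j | j < d].

Lemma binary_expansion (n m : nat) : (m < 2 ^ n)%N ->
  m = (\sum_(i < n) odd (m %/ 2 ^ i) * 2 ^ i)%N.
Proof.
elim: n m => [|n IH] m; first by rewrite big_ord0; case: m.
rewrite expnS mul2n => hm.
have hm2 : (m./2 < 2 ^ n)%N by rewrite ltn_half_double.
rewrite big_ord_recl /= expn0 divn1 muln1 -{1}(odd_double_half m).
congr (_ + _)%N; rewrite [in LHS](IH _ hm2) -mul2n big_distrr /=.
apply: eq_bigr => i _; rewrite /bump /= add1n expnS divnMA divn2.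
by rewrite mulnCA.
Qed.

Lemma bvecE (d : nat) (l : 'I_(2 ^ d.-1)) : (0 < d)%N ->
  l.+1 = (1 + \sum_(j < d) tnth (bvec l) j * 2 ^ (d.-1 - j))%N.
Proof.
case: d l => // d l _; rewrite add1n; congr _.+1.
rewrite [LHS](@binary_expansion d.+1); last first.
  by rewrite (leq_trans (ltn_ord l))// leq_exp2l.
rewrite (reindex_inj rev_ord_inj) /=; apply: eq_bigr => j _.
by rewrite tnth_mktuple subSS.
Qed.

Section pi_law.
Context (R : realType) (d : nat) (l : 'I_(2 ^ d.-1)).

Let half : {nonneg R} := (2^-1 : R)%:nng.

Definition pi_law : set (d.-tuple bool) -> \bar R :=
  measure_add (mscale half (dirac (bvec l))) (mscale half (dirac (bvecC l))).

HB.instance Definition _ := Measure.on pi_law.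

Let pi_law_setT : pi_law setT = 1%E.
Proof.
rewrite /pi_law measure_addE /= /mscale /= !diracT !mule1 -EFinD.
by congr EFin; rewrite /= [RHS](@splitr R 1) !div1r.
Qed.

HB.instance Definition _ := Measure_isProbability.Build _ _ _ pi_law pi_law_setT.

Lemma expectation_pi_law (f : d.-tuple bool -> R) : measurable_fun setT f ->
  expectation pi_law f = (2^-1 * (f (bvec l) + f (bvecC l)))%:E.
Proof.
move=> mf; have mfE : measurable_fun setT (EFin \o f) by exact/measurable_EFinP.
have ge0 (g : d.-tuple bool -> \bar R) : measurable_fun setT g ->
    (forall x, 0 <= g x)%E ->
    (\int[pi_law]_x g x = 2^-1%:E * g (bvec l) + 2^-1%:E * g (bvecC l))%E.
  move=> mg g0.
  rewrite ge0_integral_measure_add// !ge0_integral_mscale//.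
  by rewrite !integral_dirac// !diracT !mul1e.
rewrite unlock integralE !ge0//; [|exact: measurable_funeneg|exact: measurable_funepos].
rewrite !funeposE !funenegE /= -!EFin_max -!EFinM -!EFinD; congr EFin.
have maxE (x : R) : Num.max x 0 - Num.max (- x) 0 = x.
  by case: (leP x 0) => x0; [rewrite max_l ?oppr_ge0// opprK add0r
                            | rewrite max_r ?oppr_le0 ?ltW// subr0].
by rewrite -!mulrDr -mulrBr opprD addrACA !maxE.
Qed.

Definition rho_pi : 'M[R]_d := corr_mx pi_law (@bit R d).

Lemma rho_piE (i j : 'I_d) :
  rho_pi i j = 2 * (tnth (bvec l) i == tnth (bvec l) j)%:R - 1.
Proof.
have mbit k : measurable_fun setT (@bit R d k).
  apply: (@measurableT_comp _ _ _ _ _ _ (fun b : bool => b%:R : R)) => //.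
  exact: measurable_tnth.
have Ebit k : expectation pi_law (@bit R d k) = (2^-1)%:E.
  rewrite expectation_pi_law// /bit [tnth (bvecC l) k]tnth_mktuple.
  by case: (tnth _ k) => /=; rewrite ?addr0 ?add0r mulr1.
have cov k m : covariance pi_law (@bit R d k) (@bit R d m) =
    (4^-1 * (2 * (tnth (bvec l) k == tnth (bvec l) m)%:R - 1))%:E.
  rewrite unlock !Ebit expectation_pi_law; last first.
    by apply: measurable_funM; apply: measurable_funB => //; exact: measurable_cst.
  congr EFin; rewrite !fctE /bit /=.
  rewrite [tnth (bvecC l) k]tnth_mktuple [tnth (bvecC l) m]tnth_mktuple.
  by case: (tnth _ k); case: (tnth _ m); rewrite /=; field.
rewrite mxE /pearson /variance !cov /= !eqxx.
have -> : 4^-1 * (2 * 1 - 1) * (4^-1 * (2 * 1 - 1)) = (4^-1 : R) ^+ 2 by field.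
by rewrite sqrtr_sqr ger0_norm ?invr_ge0//; field.
Qed.

End pi_law.

Section construction.
Context (R : realType) (disp : measure_display) (T : measurableType disp)
  (Pr : probability T R) (d : nat).

(* [L] is the random index: it is drawn with weights [alpha], and given [L = l]
   the vector [B] is [bvec l] or [bvecC l] with probability [1/2] each. *)
Definition two_stage_draw (alpha : 'I_(2 ^ d.-1) -> R) (L : T -> 'I_(2 ^ d.-1))
    (B : {RV Pr >-> d.-tuple bool}) : Prop :=
  forall l,
    [/\ measurable (L @^-1` [set l]),
        Pr (L @^-1` [set l]) = (alpha l)%:E,
        Pr (L @^-1` [set l] `&` B @^-1` [set bvec l]) = (alpha l * 2^-1)%:E
      & Pr (L @^-1` [set l] `&` B @^-1` [set bvecC l]) = (alpha l * 2^-1)%:E].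

Variables (B : {RV Pr >-> d.-tuple bool}) (U : {RV Pr >-> R}).

Definition mixX (j : 'I_d) (w : T) : R :=
  bit R j (B w) * U w + (1 - bit R j (B w)) * (1 - U w).

Lemma measurable_mixX (j : 'I_d) : measurable_fun setT (mixX j).
Proof.
have mb : measurable_fun setT (fun w => bit R j (B w)).
  apply: (@measurableT_comp _ _ _ _ _ _ (fun b : bool => b%:R : R)) => //.
  apply: (@measurableT_comp _ _ _ _ _ _ (fun v : d.-tuple bool => tnth v j)) => //.
  exact: measurable_tnth.
by apply: measurable_funD; apply: measurable_funM => //; apply: measurable_funB.
Qed.

HB.instance Definition _ (j : 'I_d) :=
  isMeasurableFun.Build _ _ _ _ (mixX j) (measurable_mixX j).

Definition mixX_RV (j : 'I_d) : {RV Pr >-> R} := mixX j.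

End construction.

(* Main.v *)
From HB Require Import structures.
Require Import Defs.
From mathcomp Require Import all_boot all_order all_algebra.
From mathcomp Require Import all_classical all_reals all_analysis.
From mathcomp Require Import measurable_realfun ring lra.
Set Implicit Arguments.
Unset Strict Implicit.
Unset Printing Implicit Defensive.
Import Order.TTheory GRing.Theory Num.Theory.
Import numFieldNormedType.Exports.
Local Open Scope classical_set_scope.
Local Open Scope ring_scope.

(** Let [Q] be the law with distribution function [G], symmetric about [c], and
    write [q] for the quantile function of [G].

    Both [U] and [1 - U] are uniform on (0, 1), and [U] is independent of [B],
    so every [X_j], which is [U] or [1 - U] according to the bit [B_j], is
    uniform on (0, 1) ([uniform01_mixX]). Hence [F_j (X_j) = X_j] almost surely,
    and [Y_j = q (X_j)] has law [Q] ([quantile_law]): its mean is [c]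
    ([mean_center]) and its variance is [v = E (Y - c)^2] with [Y] of law
    [Q], which is finite by assumption and positive because [Q] is not a Dirac
    mass ([second_moment_gt0]).

    Symmetry of [Q] gives [q (1 - u) = 2 c - q u] for all [u] in (0, 1) outside
    a countable set ([quantile_reflect]). Therefore, almost surely,
    [Y_j - c = s_j (q U - c)] with the sign [s_j = 1] if [B_j = 1] and
    [s_j = -1] otherwise ([quantile_mixX_ae]). Independence of [U] and [B]
    then yields [Cov (Y_i, Y_j) = v E (s_i s_j) = v (2 Pr (B_i = B_j) - 1)]
    ([covariance_quantile_mixX]), so that the correlation of [Y_i] and [Y_j] is
    [2 Pr (B_i = B_j) - 1].

    Finally the agreement of two coordinates is insensitive to complementing the
    vector, so on the event [L = l] the bits [B_i] and [B_j] almost surely agree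
    or almost surely differ, according to [b (l)], and [Pr (B_i = B_j)] is the
    sum of the [alpha l] over those [l] with [b_i (l) = b_j (l)]
    ([two_stage_draw_agree]). This turns [2 Pr (B_i = B_j) - 1] into the entry
    [P i j] of the representation. *)

Lemma measurable_preimage (d d' : measure_display) (T : measurableType d)
    (T' : measurableType d') (X : {mfun T >-> T'}) (A : set T') :
  measurable A -> measurable (X @^-1` A).
Proof.
by move=> mA; rewrite -[X in measurable X]setTI; exact: (measurable_funP X).
Qed.

(** * Quantile functions *)

Lemma eq_probability_cdf (R : realType)
    (Q1 Q2 : probability (measurableTypeR R) R) :
  (forall x, Q1 [set` `]-oo, x]] = Q2 [set` `]-oo, x]]) ->
  forall A, measurable A -> Q1 A = Q2 A.
Proof.
move=> Q12 A mA.
have compl B : measurable B -> Q1 B = Q2 B -> Q1 (~` B) = Q2 (~` B).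
  by move=> mB eB; rewrite !probability_setC// eB.
apply: (@measure_unique _ R (measurableTypeR R)
  [set B | exists x, B = [set` `]x, +oo[]]
  (fun n => [set` `](- n%:R), +oo[])) => //.
- exact: RGenOInfty.measurableE.
- move=> _ _ [x ->] [y ->]; exists (Num.max x y).
  by apply/seteqP; split=> z /=; rewrite !in_itv/= !andbT gt_max => /andP.
- by move=> i; exists (- i%:R).
- apply/seteqP; split=> // x _; exists (Num.truncn `|x|).+1 => //=.
  rewrite in_itv/= andbT ltrNl (le_lt_trans (ler_norm _))// normrN.
  exact: truncnS_gt.
- by move=> _ [x ->]; rewrite -setCitvl; apply: compl => //; exact: Q12.
- by move=> k; rewrite -ge0_fin_numE// fin_num_measure.
Qed.

Section quantile.
Context (R : realType) (Q : probability (measurableTypeR R) R) (G : R -> R).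
Hypothesis hG : forall x, Q [set` `]-oo, x]] = (G x)%:E.

Let idTR : measurableTypeR R -> R := idfun.

#[local] HB.instance Definition _ :=
  @isMeasurableFun.Build _ _ _ _ idTR (@measurable_id _ _ setT).

Let nd : {homo G : x y / x <= y}.
Proof.
move=> x y xy; rewrite -lee_fin -!hG le_measure ?inE//.
by move=> z /=; rewrite !in_itv/= => /le_trans; apply.
Qed.

Let cdfE : cdf (idTR : {RV Q >-> R}) = EFin \o G.
Proof.
apply/funext => x.
by rewrite /cdf /distribution /pushforward preimage_id hG.
Qed.

Let G_lt u : 0 < u -> exists x, G x < u.
Proof.
move=> u0; have := cvg_cdfNy0 (idTR : {RV Q >-> R}).
rewrite cdfE => /fine_cvgP[_] /cvgrPdist_lt /(_ u u0) [M [_ /(_ (M - 1))]] /=.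
rewrite ltrBlDr ltrDl ltr01 sub0r normrN => /(_ isT) h; exists (M - 1).
by rewrite (le_lt_trans (ler_norm _)).
Qed.

Let G_gt u : u < 1 -> exists x, u < G x.
Proof.
rewrite -subr_gt0 => u0; have := cvg_cdfy1 (idTR : {RV Q >-> R}).
rewrite cdfE => /fine_cvgP[_] /cvgrPdist_lt /(_ _ u0) [M [_ /(_ (M + 1))]] /=.
rewrite ltrDl ltr01 => /(_ isT) h; exists (M + 1).
have := le_lt_trans (ler_norm _) h; by rewrite ltrD2l ltrN2.
Qed.

Let G_right x u : G x < u -> exists2 y, x < y & G y < u.
Proof.
rewrite -subr_gt0 => u0.
have := @cdf_right_continuous _ _ _ _ (idTR : {RV Q >-> R}) x.
rewrite cdfE => /fine_cvgP[_] /cvgrPdist_lt /(_ _ u0) /= h.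
have [y /= [xy]] := filter_ex (filterI (nbhs_right_gt x) h).
by move=> /ltr_normlP [+ _]; rewrite opprB ltrD2r => yu; exists y.
Qed.

(** The Galois connection between [G] and its quantile function; it rests on
    right continuity of [G], and on its limits at infinity for the set whose
    infimum is taken to be nonempty and bounded below. *)
Lemma quantile_le u x : 0 < u < 1 -> (quantile G u <= x) = (u <= G x).
Proof.
move=> /andP[u0 u1].
have [a Ga] := G_lt u0; have [b Gb] := G_gt u1.
have lba : lbound [set x | u <= G x] a.
  move=> y /= uy; rewrite leNgt; apply/negP => /ltW /nd.
  by rewrite leNgt (lt_le_trans Ga).
apply/idP/idP => [|ux]; last by apply: ge_inf => //; exists a.
move=> qx; rewrite leNgt; apply/negP => /G_right[y xy Gy].
have /inf_lt[|z /= uz zy] := le_lt_trans qx xy.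
  by exists b; exact: ltW.
by have := le_lt_trans (nd (ltW zy)) Gy; rewrite ltNge uz.
Qed.

Lemma measurable_quantile : measurable_fun setT (quantile G : R -> R).
Proof.
(* Outside (0, 1) the infimum is a default value, except possibly at 1. *)
have -> : quantile G = fun u => if (0 < u) && (u < 1) then quantile G u
                                else if u == 1 then quantile G 1 else 0.
  apply/funext => u; case: ifPn => //; rewrite negb_and -!leNgt => uO.
  case: eqVneq => [->//|u1]; case/orP: uO => [u0|u1'].
    rewrite /quantile inf_out// => -[_ [m hm]].
    have : m <= m - 1.
      by apply: hm => /=; rewrite (le_trans u0)// -lee_fin -hG measure_ge0.
    by rewrite leNgt ltrBlDr ltrDl ltr01.
  rewrite /quantile (_ : mkset _ = set0) ?inf0//.
  apply/seteqP; split=> // x /=; apply/negP; rewrite -ltNge.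
  rewrite (@le_lt_trans _ _ 1)// ?lt_neqAle 1?eq_sym ?u1//.
  by rewrite -lee_fin -hG probability_le1.
apply: measurable_fun_if => //.
- by apply: measurable_and => //; exact: measurable_fun_ltr.
- set D := _ `&` _.
  have -> : D = [set` `]0, 1[].
    by apply/seteqP; split=> u; rewrite /D /= in_itv/= => // -[].
  apply: (measurability _ (RGenOInfty.measurableE R)) => _ [_ [x ->] <-].
  have -> : `]0, 1[ `&` quantile G @^-1` `]x, +oo[ =
            `]0, 1[%classic `&` `]G x, +oo[.
    by apply/seteqP; split => u [/=]; rewrite !in_itv/= !andbT => u01 h;
      split=> //; move: h; rewrite ltNge [in X in _ -> X]ltNge quantile_le.
  exact: measurableI.
- apply: measurable_funTS; apply: measurable_fun_ifT => //.
  exact: measurable_fun_eqr.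
Qed.

Variable c : R.
Hypothesis sym : forall A : set (measurableTypeR R), measurable A ->
  Q ((fun y => y - c) @^-1` A) = Q ((fun y => c - y) @^-1` A).

(* The reflection of the ray below [x] about [c] has the same mass. *)
Let upper x : Q [set` `[2 * c - x, +oo[] = (G x)%:E.
Proof.
rewrite -hG; have := sym (measurable_itv `]-oo, x - c]).
rewrite (_ : _ @^-1` _ = [set` `]-oo, x]]); last first.
  by apply/seteqP; split=> y; rewrite /= !in_itv/= lerD2r.
rewrite (_ : _ @^-1` _ = [set` `[2 * c - x, +oo[]) => [->//|].
by apply/seteqP; split=> y; rewrite /= !in_itv/= andbT => h; lra.
Qed.

Let upper_cover y : 1 <= G (2 * c - y) + G y.
Proof.
rewrite -lee_fin EFinD -upper -hG.
rewrite (_ : 2 * c - (2 * c - y) = y); last by ring.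
rewrite -(@probability_setT _ _ _ Q) -(setUv `[y, +oo[%classic).
apply: (le_trans (measureU2 _ _ _)) => //; first exact: measurableC.
rewrite leeD2l// le_measure ?inE//; first exact: measurableC.
by rewrite !setCitvr => z /=; rewrite !in_itv/= => /ltW.
Qed.

Let upper_disjoint x y : x < y -> G x + G (2 * c - y) <= 1.
Proof.
move=> xy; rewrite -lee_fin EFinD -(upper (2 * c - y)) -hG.
rewrite (_ : 2 * c - (2 * c - y) = y); last by ring.
rewrite -measureU//; first exact: probability_le1 (measurableU _ _ _ _).
apply/seteqP; split => // z [/=]; rewrite !in_itv/= andbT => zx yz.
by have := le_lt_trans (le_trans yz zx) xy; rewrite ltxx.
Qed.

(** The quantile function of a law symmetric about [c] is antisymmetric about
    (1/2, c), except at levels on which [G] is constant over an interval.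
    Such an interval contains a rational, so the exceptions lie in the countable
    set of values of [G] at rationals. *)
Lemma quantile_reflect u : 0 < u < 1 -> (forall r : rat, G (ratr r) != u) ->
  quantile G (1 - u) = 2 * c - quantile G u.
Proof.
move=> u01 uG; have u01' : 0 < 1 - u < 1 by lra.
apply/eqP; rewrite eq_le; apply/andP; split; rewrite leNgt; apply/negP => lt.
(* Rays of masses less than [u] and [1 - u] would cover the line. *)
- have [yl yr] := midf_lt lt; set y := (_ / 2) in yl yr.
  have := upper_cover y; rewrite leNgt => /negP; apply.
  have : G y < 1 - u by rewrite ltNge -quantile_le// -ltNge.
  have : G (2 * c - y) < u by rewrite ltNge -quantile_le// -ltNge; lra.
  lra.
(* Disjoint rays have masses at least [u] and [1 - u], so [G r = u]. *)
- have [r] : exists r : rat,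
      ratr r \in `]quantile G u, 2 * c - quantile G (1 - u)[.
    by apply: rat_in_itvoo; lra.
  rewrite in_itv/= => /andP[qr rq].
  have [yl yr] := midf_lt rq; set y := (_ / 2) in yl yr.
  have := upper_disjoint yl.
  have : 1 - u <= G (2 * c - y) by rewrite -quantile_le//; lra.
  have : u <= G (ratr r) by rewrite -quantile_le// ltW.
  move=> Gr Gy Gry; have /negP := uG r; apply.
  by rewrite eq_le Gr andbT; lra.
Qed.

End quantile.

(** * The uniform law on the unit interval *)

Section uniform.
Context (R : realType).
Local Notation unif := (uniform_prob (@ltr01 R)).

Lemma uniform_prob01E (A : set R) : measurable A ->
  unif A = lebesgue_measure (A `&` `[0, 1]).
Proof.
move=> mA; rewrite /uniform_prob integral_uniform_pdf.
rewrite (eq_integral (cst 1%E)) => [|x].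
  by rewrite integral_cst ?mul1e//; exact: measurableI.
by rewrite inE /= in_itv/= /uniform_pdf => -[_ ->]; rewrite subr0 invr1.
Qed.

Lemma uniform_prob01_lec (x : R) :
  unif [set` `]-oo, x]] = (Num.max 0 (Num.min x 1))%:E.
Proof.
rewrite uniform_prob01E//; have [x0|x0] := ltP x 0.
  rewrite (_ : _ `&` _ = set0) ?measure0.
    by rewrite min_l ?max_l// ltW// (lt_trans x0).
  by apply/seteqP; split=> // y [/=]; rewrite !in_itv/= => ? /andP[]; lra.
rewrite (_ : _ `&` _ = [set` `[0, Num.min x 1]]).
  rewrite lebesgue_measure_itv/= lte_fin oppr0 adde0 maxElt.
  by case: ifP => // _; rewrite sube0.
apply/seteqP; split=> y; rewrite /= !in_itv/= le_min.
  by move=> [-> /andP[-> ->]].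
by move=> /and3P[-> -> ->].
Qed.

Lemma uniform_prob01_gec (x : R) :
  unif [set` `[x, +oo[] = (1 - Num.max 0 (Num.min x 1))%:E.
Proof.
rewrite uniform_prob01E//; have [x0|x0] := ltP 1 x.
  rewrite (_ : _ `&` _ = set0) ?measure0.
    by rewrite max_r// subrr.
  apply/seteqP; split=> // y [/=].
  by rewrite !in_itv/= andbT => ? /andP[]; lra.
rewrite (_ : _ `&` _ = [set` `[Num.max 0 x, 1]]).
  rewrite lebesgue_measure_itv/= lte_fin -EFinB.
  by case: ltP => // h; congr EFin; move: h; rewrite maxElt; case: ltP; lra.
apply/seteqP; split=> y; rewrite /= !in_itv/= andbT ge_max.
  by move=> [-> /andP[-> ->]].
by move=> /andP[/andP[-> ->] ->].
Qed.

Lemma uniform_prob01_onem (A : set (measurableTypeR R)) : measurable A ->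
  unif ((fun x => 1 - x) @^-1` A) = unif A.
Proof.
pose f : measurableTypeR R -> measurableTypeR R := fun x => 1 - x.
have mf : measurable_fun setT f by exact: measurable_funB.
pose fM := isMeasurableFun.Build _ _ _ _ f mf.
pose F : {mfun measurableTypeR R >-> measurableTypeR R} := HB.pack f fM.
move=> mA; apply: (@eq_probability_cdf R (distribution unif F) unif) => // x.
rewrite /distribution /pushforward /=.
rewrite (_ : _ @^-1` _ = [set` `[1 - x, +oo[]); last first.
  by apply/seteqP; split=> y; rewrite /= !in_itv/= andbT /f => ?; lra.
rewrite uniform_prob01_gec uniform_prob01_lec; congr EFin.
by case: (leP x 1) => ?; case: (leP (1 - x) 1) => ?; case: (leP 0 (1 - x)) => ?;
  case: (leP 0 x) => ?; rewrite ?(max_r ler01); lra.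
Qed.

Lemma uniform_prob01_countable (A : set R) : countable A -> unif A = 0%E.
Proof.
move=> cA; have mA : measurable A by apply: countable_measurable => // t.
have /null_content_dominatesP := @dominates_uniform_prob R 0 1 ltr01.
by apply => //; exact: countable_lebesgue_measure0.
Qed.

Lemma uniform_prob01_oo : unif [set` `]0, 1[] = 1%E.
Proof.
rewrite uniform_prob01E// setIidl; last exact: subset_itv_oo_cc.
by rewrite lebesgue_measure_itv/= lte_fin ltr01 oppr0 adde0.
Qed.

Lemma uniform_prob01_setC_oo : unif (~` [set` `]0, 1[]) = 0%E.
Proof.
have mI : measurable (`]0, 1[%classic : set (measurableTypeR R)) by [].
have := probability_setC unif mI.
by rewrite [X in (1 - X)%E]uniform_prob01_oo subee.
Qed.

Lemma uniform_prob01_setI (A : set (measurableTypeR R)) : measurable A ->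
  unif A = unif (A `&` `]0, 1[).
Proof.
move=> mA.
have mI : measurable (`]0, 1[%classic : set (measurableTypeR R)) by [].
have AI : A `\` `]0, 1[ `<=` ~` `]0, 1[ by move=> x [].
have := measureDI unif mA mI.
rewrite (subset_measure0 (measurableD mA mI) (measurableC mI) AI).
  by rewrite add0e.
exact: uniform_prob01_setC_oo.
Qed.

(** Inverse transform sampling: the quantile function of [Q] sends the uniform
    law to [Q]. Only its values on (0, 1) matter. *)
Lemma quantile_law (Q : probability (measurableTypeR R) R) (G : R -> R)
    (hG : forall x, Q [set` `]-oo, x]] = (G x)%:E)
    (h : measurableTypeR R -> measurableTypeR R)
    (mh : measurable_fun setT h)
    (hE : forall u, 0 < u < 1 -> h u = quantile G u)
    (A : set (measurableTypeR R)) : measurable A ->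
  unif (h @^-1` A) = Q A.
Proof.
have mpre x : measurable (h @^-1` `]-oo, x]).
  by rewrite -[X in measurable X]setTI; exact: mh.
pose hM := isMeasurableFun.Build _ _ _ _ h mh.
pose F : {mfun measurableTypeR R >-> measurableTypeR R} := HB.pack h hM.
move=> mA; apply: (@eq_probability_cdf R (distribution unif F) Q) => // x.
rewrite /distribution /pushforward /= hG uniform_prob01_setI//.
rewrite (_ : _ `&` _ = [set` `]-oo, G x]] `&` `]0, 1[); last first.
  by apply/seteqP; split=> u [/=]; rewrite !in_itv/= => + u01;
    rewrite (hE _ u01) (quantile_le hG).
rewrite -uniform_prob01_setI// uniform_prob01_lec; congr EFin.
have : (0 <= (G x)%:E <= 1)%E by rewrite -hG measure_ge0 probability_le1.
by rewrite !lee_fin => /andP[G0 G1]; rewrite min_l// max_r.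
Qed.

End uniform.

(** * Integrals of functions of random variables *)

Section indep.
Context (R : realType) (disp : measure_display) (T : measurableType disp)
  (Pr : probability T R).

(** The integral of a nonnegative function of [X] over an event about an
    independent [Y] factors: the law of [X] under [Pr] restricted to the event
    is the law of [X] scaled by the probability of the event. *)
Lemma ge0_integral_indep (d1 d2 : measure_display) (T1 : measurableType d1)
    (T2 : measurableType d2) (X : {RV Pr >-> T1}) (Y : {RV Pr >-> T2})
    (S : set T2) (g : T1 -> \bar R) :
  independent_RV X Y -> measurable S -> measurable_fun setT g ->
  (forall x, 0 <= g x)%E ->
  (\int[Pr]_(w in Y @^-1` S) g (X w) = Pr (Y @^-1` S) * \int[Pr]_w g (X w))%E.
Proof.
move=> XY mS mg g0; set D := Y @^-1` S.
have mD : measurable D by exact: measurable_preimage.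
pose k : {nonneg R} := NngNum (fine_ge0 (measure_ge0 Pr D)).
have kE : k%:num%:E = Pr D by rewrite /k /= fineK// fin_num_measure.
have mX : measurable_fun setT X by [].
have mgX : measurable_fun setT (g \o X) by exact: measurableT_comp.
rewrite -[X in (_ * X)%E](ge0_integral_distribution X mg g0).
transitivity (\int[mrestr Pr mD]_w (g \o X) w)%E.
  rewrite (@ge0_negligible_integral _ _ _ _ setT (~` D)) ?setTD ?setCK//.
  - by apply: eq_measure_integral => A mA AD; rewrite /= /mrestr setIidl.
  - exact: measurableC.
  - by move=> x _; exact: g0.
  - by rewrite /= /mrestr setICl measure0.
transitivity (\int[pushforward (mrestr Pr mD) X]_y g y)%E.
  by rewrite ge0_integral_pushforward.
rewrite -kE -ge0_integral_mscale//.
apply: eq_measure_integral => A mA _.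
rewrite /= /mscale /distribution /pushforward /= /mrestr.
by have /= := XY _ _ mA mS; rewrite -/D => ->; rewrite -kE muleC.
Qed.

End indep.

Section transfer.
Context (R : realType) (disp : measure_display) (T : measurableType disp)
  (Pr : probability T R)
  (Q : probability (measurableTypeR R) R) (W : {RV Pr >-> measurableTypeR R}).
Hypothesis lawW : forall A, measurable A -> distribution Pr W A = Q A.

Lemma integrable_law (f : measurableTypeR R -> \bar R) :
  Q.-integrable setT f -> Pr.-integrable setT (f \o W).
Proof.
move=> /integrableP[mf fi]; apply/integrableP; split.
  exact: measurableT_comp.
apply: le_lt_trans fi; rewrite le_eqVlt; apply/orP; left; apply/eqP.
rewrite -(@ge0_integral_distribution _ _ _ _ _ Pr W (fun y => `|f y|)%E)//.
  by apply: eq_measure_integral => A mA _; exact: lawW.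
exact: measurableT_comp.
Qed.

Lemma integral_law (f : measurableTypeR R -> \bar R) : Q.-integrable setT f ->
  (\int[Pr]_w f (W w) = \int[Q]_y f y)%E.
Proof.
move=> fi; have /integrableP[mf _] := fi.
rewrite -(integral_distribution mf (integrable_law fi)).
by apply: eq_measure_integral => A mA _; exact: lawW.
Qed.

End transfer.

(** * Moments of a symmetric law *)

Section moments.
Context (R : realType) (Q : probability (measurableTypeR R) R).
Hypothesis Q2 : (\int[Q]_y (y ^+ 2)%:E < +oo)%E.

Lemma integrable_second_moment (a : R) :
  Q.-integrable setT (fun y => ((y - a) ^+ 2)%:E).
Proof.
have mB : measurable_fun setT (fun y : R => y - a) by exact: measurable_funB.
have hy : Q.-integrable setT (fun y : measurableTypeR R => (y ^+ 2)%:E).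
  apply/integrableP; split.
    by apply/measurable_EFinP; exact: measurable_funX.
  apply: le_lt_trans Q2; rewrite le_eqVlt; apply/orP; left; apply/eqP.
  by apply: eq_integral => y _; rewrite gee0_abs// lee_fin sqr_ge0.
have ha := finite_measure_integrable_cst Q (2 * a ^+ 2) measurableT.
have h2 := integrableD measurableT (integrableZl measurableT 2 hy) ha.
apply: le_integrable h2 => //.
  by apply/measurable_EFinP; exact: measurable_funX.
move=> y _; rewrite lee_fin !ger0_norm ?sqr_ge0//; last first.
  by rewrite addr_ge0// mulr_ge0// sqr_ge0.
by rewrite -subr_ge0 /= (_ : _ - _ = (y + a) ^+ 2) ?sqr_ge0//; ring.
Qed.

Lemma integrable_first_moment (a : R) :
  Q.-integrable setT (fun y => (y - a)%:E).
Proof.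
have h1 := finite_measure_integrable_cst Q 1 measurableT.
have h2 := integrableD measurableT h1 (integrable_second_moment a).
apply: le_integrable h2 => //.
  by apply/measurable_EFinP; exact: measurable_funB.
move=> y _; rewrite lee_fin [leRHS]ger0_norm ?addr_ge0 ?sqr_ge0//.
rewrite /= -[X in _ <= _ + X]real_normK ?num_real//; set z := `|y - a|.
(* [z <= 1 + z ^+ 2] *)
have : 0 <= (z - 1) ^+ 2 + z ^+ 2 by rewrite addr_ge0// sqr_ge0.
have : 0 <= z ^+ 2 by exact: sqr_ge0.
by rewrite sqrrB1 mulr2n; lra.
Qed.

Lemma integrable_id : Q.-integrable setT (fun y => y%:E).
Proof.
apply: eq_integrable (integrable_first_moment 0) => // y _.
by rewrite /= subr0.
Qed.

Lemma second_moment_gt0 (a : R) : ~ (exists b, Q [set b] = 1%E) ->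
  (0 < \int[Q]_y ((y - a) ^+ 2)%:E)%E.
Proof.
move=> Q1; rewrite lt_neqAle integral_ge0 ?andbT; last first.
  by move=> y _; rewrite lee_fin sqr_ge0.
apply/eqP => /esym E0; apply: Q1; exists a.
have mf : measurable_fun setT (fun y : measurableTypeR R => ((y - a) ^+ 2)%:E).
  by case/integrableP : (integrable_second_moment a).
have [N [mN N0 sub]] :
    ae_eq Q setT (fun y : measurableTypeR R => ((y - a) ^+ 2)%:E) (cst 0%E).
  apply/(ae_eq_integral_abs Q measurableT mf).
  rewrite -[RHS]E0; apply: eq_integral => y _.
  by rewrite gee0_abs// lee_fin sqr_ge0.
have ma : measurable [set a : measurableTypeR R] by [].
have aN : ~` [set a] `<=` N.
  move=> y /= ya; apply: sub => /= /(_ Logic.I) [/eqP].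
  by rewrite sqrf_eq0 subr_eq0 => /eqP.
have := probability_setC Q ma.
rewrite (subset_measure0 _ mN aN N0); last exact: measurableC.
have /fineK <- := fin_num_measure Q _ ma.
by rewrite -EFinB => -[/esym/eqP]; rewrite subr_eq0 => /eqP ->.
Qed.

Variable c : R.
Hypothesis sym : forall A : set (measurableTypeR R), measurable A ->
  Q ((fun y => y - c) @^-1` A) = Q ((fun y => c - y) @^-1` A).

Lemma centered_mean : (\int[Q]_y (y - c)%:E = 0)%E.
Proof.
pose f : measurableTypeR R -> measurableTypeR R := fun y => y - c.
pose g : measurableTypeR R -> measurableTypeR R := fun y => c - y.
have mf : measurable_fun setT f by exact: measurable_funB.
have mg : measurable_fun setT g by exact: measurable_funB.
have ifi := integrable_first_moment c.
have igi : Q.-integrable setT (EFin \o g).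
  rewrite (_ : EFin \o g = (fun y => - (y - c)%:E)%E).
    exact: integrableN.
  by apply/funext => y /=; rewrite /g opprB.
have E : (\int[Q]_y (f y)%:E = \int[Q]_y (g y)%:E)%E.
  transitivity (\int[pushforward Q f]_y y%:E)%E.
    by rewrite (integral_pushforward mf)//; exact/measurable_EFinP.
  transitivity (\int[pushforward Q g]_y y%:E)%E; last first.
    by rewrite (integral_pushforward mg)//; exact/measurable_EFinP.
  by apply: eq_measure_integral => A mA _; exact: sym.
have : (\int[Q]_y (g y)%:E = - \int[Q]_y (f y)%:E)%E.
  rewrite -integralN//; last exact: integrable_add_def.
  by apply: eq_integral => y _ /=; rewrite /g /f opprB.
rewrite -E; have /fineK <- := integrable_fin_num measurableT ifi.
by rewrite -EFinN => -[] e; congr EFin; move: e; lra.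
Qed.

Lemma mean_center : (\int[Q]_y y%:E = c%:E)%E.
Proof.
rewrite (eq_integral
  (fun y : measurableTypeR R => (y - c)%:E + (cst c y)%:E)%E); last first.
  by move=> y _; rewrite /= -EFinD subrK.
rewrite integralD//; [|exact: integrable_first_moment|
  exact: finite_measure_integrable_cst].
rewrite centered_mean add0e.
by have := expectation_cst Q c; rewrite unlock.
Qed.

End moments.

(** * Random binary vectors *)

Lemma measurable_tuple_bool (d : nat) (S : set (d.-tuple bool)) : measurable S.
Proof.
apply: countable_measurable => [v|]; last exact: countableP.
rewrite (_ : [set v] = ~` \bigcup_(k in setT)
    ~` ((fun w : d.-tuple bool => tnth w k) @^-1` [set tnth v k])).
  apply: measurableC; apply: countable_bigcupT_measurable => // k.
  apply: measurableC; rewrite -[X in measurable X]setTI.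
  exact: measurable_tnth.
rewrite setC_bigcup; apply/seteqP; split => [_ -> k _|w h] /=.
  by move=> h; apply: h.
by apply: eq_from_tnth => k; apply: contrapT; exact: h.
Qed.

Lemma tnth_bvecC (d : nat) (l : 'I_(2 ^ d.-1)) (k : 'I_d) :
  tnth (bvecC l) k = ~~ tnth (bvec l) k.
Proof. by rewrite [LHS]tnth_mktuple. Qed.

Section agree.
Context (R : realType) (disp : measure_display) (T : measurableType disp)
  (Pr : probability T R) (d : nat) (hd : (0 < d)%N)
  (B : {RV Pr >-> d.-tuple bool})
  (alpha : 'I_(2 ^ d.-1) -> R) (L : T -> 'I_(2 ^ d.-1)).
Hypothesis hB : two_stage_draw alpha L B.

Lemma bvec_neq_bvecC l : bvec l <> @bvecC d l.
Proof.
move=> /(congr1 (fun v => tnth v (Ordinal hd))).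
by rewrite tnth_bvecC; case: (tnth _ _).
Qed.

(** On the event [L = l], the vector [B] is almost surely [bvec l] or
    [bvecC l]: being distinct, these two carry the whole mass [alpha l]. *)
Lemma two_stage_draw_symmetric l (S : set (d.-tuple bool)) :
  S (bvec l) -> S (bvecC l) ->
  Pr (L @^-1` [set l] `&` B @^-1` S) = (alpha l)%:E.
Proof.
move=> Sb SC; have [mL PL Pb PC] := hB l.
have mB V : measurable (B @^-1` V).
  by apply: measurable_preimage; exact: measurable_tuple_bool.
have mLB V : measurable (L @^-1` [set l] `&` B @^-1` V) by exact: measurableI.
apply/eqP; rewrite eq_le; apply/andP; split.
  by rewrite -PL le_measure ?inE//.
have <- : Pr (L @^-1` [set l] `&` B @^-1` [set bvec l; bvecC l]) = (alpha l)%:E.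
  rewrite preimage_setU setIUr measureU//.
    by rewrite [LHS](congr2 adde Pb PC); congr EFin; rewrite -splitr.
  apply/seteqP; split => // w [[_ /= ->] [_ /=]]; exact: bvec_neq_bvecC.
rewrite le_measure ?inE//; apply: setIS => w /=.
by case=> ->.
Qed.

Lemma two_stage_draw_agree i j :
  Pr (B @^-1` [set v | tnth v i = tnth v j]) =
    (\sum_l alpha l * (tnth (bvec l) i == tnth (bvec l) j)%:R)%:E.
Proof.
set S := [set v | _].
have mB V : measurable (B @^-1` V).
  by apply: measurable_preimage; exact: measurable_tuple_bool.
have -> : B @^-1` S =
    \big[setU/set0]_(l < 2 ^ d.-1) (L @^-1` [set l] `&` B @^-1` S).
  rewrite -bigcup_seq; apply/seteqP; split=> w.
    by move=> Sw; exists (L w) => //=; rewrite mem_index_enum.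
  by move=> [l _ []].
rewrite measure_bigsetU_ord; last 2 first.
- by move=> l; have [mL _ _ _] := hB l; exact: measurableI.
- apply/trivIsetP => k l _ _ kl; apply/seteqP.
  by split => // w [[/= -> _] [/= kl' _]]; rewrite kl' eqxx in kl.
rewrite -sumEFin; apply: eq_bigr => l _.
case: eqP => h; rewrite ?mulr1 ?mulr0.
  by apply: two_stage_draw_symmetric => //; rewrite /S /= !tnth_bvecC h.
have [mL PL _ _] := hB l.
have : Pr (L @^-1` [set l] `&` B @^-1` (~` S)) = (alpha l)%:E.
  apply: two_stage_draw_symmetric => //.
  by rewrite /S /= !tnth_bvecC => /negb_inj.
have : (Pr (L @^-1` [set l]) = Pr (L @^-1` [set l] `&` B @^-1` (~` S)) +
    Pr (L @^-1` [set l] `&` B @^-1` S))%E.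
  by rewrite -preimage_setC -setDE; exact: measureDI.
rewrite PL => + PC; rewrite PC.
have /fineK <- := fin_num_measure Pr _ (measurableI _ _ mL (mB S)).
rewrite -EFinD => -[] e.
transitivity (fine (Pr (L @^-1` [set l] `&` B @^-1` S)))%:E.
  by apply/esym/fineK/fin_num_measure; exact: measurableI.
by congr EFin; move: e; lra.
Qed.

End agree.

(** * The mixture of a uniform variable and its reflection *)

Section mix.
Context (R : realType) (disp : measure_display) (T : measurableType disp)
  (Pr : probability T R) (d : nat) (B : {RV Pr >-> d.-tuple bool})
  (U : {RV Pr >-> R}).
Hypotheses (hU : uniform01 U) (hUB : independent_RV U B).

Lemma mixXE j w : mixX B U j w = if tnth (B w) j then U w else 1 - U w.
Proof. by rewrite /mixX /bit; case: (tnth _ _) => /=; ring. Qed.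

Lemma uniform01_mixX j : uniform01 (mixX_RV B U j).
Proof.
move=> A mA.
pose S : set (d.-tuple bool) := [set v : d.-tuple bool | tnth v j].
have mS : measurable S by exact: measurable_tuple_bool.
have mS' : measurable (~` S) by exact: measurable_tuple_bool.
pose A' := (fun x : R => 1 - x) @^-1` A.
have mA' : measurable A'.
  have mf : measurable_fun setT (fun x : R => 1 - x) by exact: measurable_funB.
  by rewrite -[X in measurable X]setTI; exact: mf.
have mBS : measurable (B @^-1` S) by exact: measurable_preimage.
have mBS' : measurable (B @^-1` (~` S)) by exact: measurable_preimage.
have mUA : measurable (U @^-1` A) by exact: measurable_preimage.
have mUA' : measurable (U @^-1` A') by exact: measurable_preimage.
rewrite /distribution /pushforward.
rewrite (_ : _ @^-1` A = (U @^-1` A `&` B @^-1` S) `|`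
                         (U @^-1` A' `&` B @^-1` (~` S))); last first.
  apply/seteqP; split=> w; rewrite /= mixXE /A' /S /=.
    by case: (tnth _ _) => ?; [left|right].
  by case: (tnth _ _) => -[[]|[]].
rewrite measureU//=; [|exact: measurableI|exact: measurableI|]; last first.
  by apply/seteqP; split=> // w [[_ ?] [_]].
rewrite !hUB// -![Pr (U @^-1` _)]/(distribution Pr U _) !hU//.
have -> : uniform_prob ltr01 A' = uniform_prob ltr01 A.
  exact: uniform_prob01_onem.
rewrite -ge0_muleDr// preimage_setC probability_setC//.
have /fineK <- := fin_num_measure Pr _ mBS.
by rewrite -EFinB -EFinD addrC subrK mule1.
Qed.

Lemma dist_fun_mixX j x : dist_fun (mixX_RV B U j) x = Num.max 0 (Num.min x 1).
Proof. by rewrite /dist_fun /cdf uniform01_mixX// uniform_prob01_lec. Qed.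

Lemma continuous_dist_fun_mixX j : continuous (dist_fun (mixX_RV B U j)).
Proof.
rewrite (_ : dist_fun _ =
  (cst (0 : R^o)) \max (idfun \min (cst (1 : R^o)))); last first.
  by apply/funext => x; rewrite dist_fun_mixX.
move=> x; apply: (@continuous_max _ R); first exact: cvg_cst.
by apply: (@continuous_min _ R); [exact: cvg_id|exact: cvg_cst].
Qed.

End mix.

(** * Covariances after the quantile transform *)

Section quantile_of_uniform.
Context (R : realType) (Q : probability (measurableTypeR R) R) (G : R -> R)
  (c : R).
Hypothesis hG : forall x, Q [set` `]-oo, x]] = (G x)%:E.
Hypothesis sym : forall A : set (measurableTypeR R), measurable A ->
  Q ((fun y => y - c) @^-1` A) = Q ((fun y => c - y) @^-1` A).
Hypothesis Q2 : (\int[Q]_y (y ^+ 2)%:E < +oo)%E.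

(** The quantile function precomposed with the distribution function of the
    uniform law, which is the identity on [0, 1]. *)
Definition clamp_quantile (x : measurableTypeR R) : measurableTypeR R :=
  quantile G (Num.max 0 (Num.min x 1)).

Let qc := clamp_quantile.

Lemma measurable_clamp_quantile : measurable_fun setT clamp_quantile.
Proof.
apply: (measurableT_comp (measurable_quantile hG)).
apply: measurable_maxr; first exact: measurable_cst.
by apply: measurable_minr; [exact: measurable_id|exact: measurable_cst].
Qed.

Lemma clamp_quantileE x : 0 < x < 1 -> clamp_quantile x = quantile G x.
Proof.
move=> /andP[x0 x1].
by rewrite /clamp_quantile min_l ?(ltW x1)// max_r// ltW.
Qed.

Context (disp : measure_display) (T : measurableType disp)
  (Pr : probability T R).

(** The variable [G^-1 (F (V))] for [V] uniform on (0, 1), as a function and,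
    below, as a random variable. *)
Definition quantile_fun (V : {RV Pr >-> R}) (w : T) : measurableTypeR R :=
  qc (V w).

Lemma measurable_quantile_fun (V : {RV Pr >-> R}) :
  measurable_fun setT (quantile_fun V).
Proof.
exact: (measurableT_comp measurable_clamp_quantile (measurable_funP V)).
Qed.

HB.instance Definition _ (V : {RV Pr >-> R}) :=
  isMeasurableFun.Build _ _ _ _ (quantile_fun V) (measurable_quantile_fun V).

Definition quantile_rv (V : {RV Pr >-> R}) : {RV Pr >-> measurableTypeR R} :=
  quantile_fun V.

Lemma quantile_rv_law V : uniform01 V -> forall A, measurable A ->
  distribution Pr (quantile_rv V) A = Q A.
Proof.
move=> hV A mA.
rewrite -(quantile_law hG measurable_clamp_quantile clamp_quantileE mA) -hV//.
by rewrite -[X in measurable X]setTI; exact: measurable_clamp_quantile.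
Qed.

Lemma expectation_quantile_rv V : uniform01 V ->
  expectation Pr (quantile_rv V) = c%:E.
Proof.
move=> hV; rewrite unlock.
have := integral_law (quantile_rv_law hV) (integrable_id Q2).
by rewrite (mean_center Q2 sym).
Qed.

Context (d : nat) (B : {RV Pr >-> d.-tuple bool}) (U : {RV Pr >-> R}).
Hypotheses (hU : uniform01 U) (hUB : independent_RV U B).

Let X j := mixX_RV B U j.

Let v := fine (\int[Q]_y ((y - c) ^+ 2)%:E).

Let vE : (\int[Q]_y ((y - c) ^+ 2)%:E)%E = v%:E.
Proof.
rewrite /v fineK// (integrable_fin_num measurableT)//.
exact: integrable_second_moment.
Qed.

(** Almost surely, flipping the bit [B_j] reflects the transformed variable
    about [c]. *)
Lemma quantile_mixX_ae :
  {ae Pr, forall w, forall j, quantile_rv (X j) w - c =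
    (-1) ^+ (~~ tnth (B w) j) * (quantile_rv U w - c)}.
Proof.
pose bad : set (measurableTypeR R) :=
  range (fun r : rat => G (ratr r)) `|` ~` `]0, 1[.
have cG : countable (range (fun r : rat => G (ratr r))).
  exact: sub_countable (card_image_le _ _) (countableP _).
have mG :
    measurable (range (fun r : rat => G (ratr r)) : set (measurableTypeR R)).
  by apply: countable_measurable => // t.
have mI : measurable (`]0, 1[%classic : set (measurableTypeR R)) by [].
have mbad : measurable bad by apply: measurableU => //; exact: measurableC.
exists (U @^-1` bad); split.
- exact: measurable_preimage.
- rewrite -[LHS]/(distribution Pr U bad) hU//.
  apply/eqP; rewrite -measure_le0.
  apply: (le_trans (measureU2 _ mG (measurableC mI))).
  have e : (uniform_prob (@ltr01 R) (range (fun r : rat => G (ratr r))) +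
            uniform_prob (@ltr01 R) (~` [set` `]0%R, 1%R[]) = 0)%E.
    by rewrite uniform_prob01_countable// uniform_prob01_setC_oo adde0.
  by rewrite [leLHS]e.
- move=> w /= h; apply: contrapT => nbad; apply: h => j.
  move: nbad => /not_orP[nG /contrapT]; rewrite /= in_itv/= => u01.
  rewrite /quantile_rv /quantile_fun /X /= mixXE; case: (tnth _ _) => /=.
    by rewrite expr0 mul1r.
  rewrite expr1 mulN1r /qc !clamp_quantileE//; last by lra.
  rewrite (quantile_reflect hG sym u01); first by ring.
  by move=> r; apply/eqP => e; apply: nG; exists r.
Qed.

(** For [i = j] the probability [p] is 1, so this covers the variances too. *)
Lemma covariance_quantile_mixX i j (p : R) :
  Pr (B @^-1` [set w | tnth w i = tnth w j]) = p%:E ->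
  covariance Pr (quantile_rv (X i)) (quantile_rv (X j)) = (v * (2 * p - 1))%:E.
Proof.
move=> hp; rewrite unlock !expectation_quantile_rv; [|exact: uniform01_mixX..].
rewrite unlock /=.
set S := [set w | _] in hp.
have mS : measurable S := measurable_tuple_bool S.
have mS' : measurable (~` S) := measurable_tuple_bool (~` S).
have mB V : measurable (B @^-1` V).
  by apply: measurable_preimage; exact: measurable_tuple_bool.
pose g (y : R) := ((qc y - c) ^+ 2)%:E.
have mg : measurable_fun setT g.
  apply/measurable_EFinP; apply: measurable_funX; apply: measurable_funB => //.
  exact: measurable_clamp_quantile.
have g0 y : (0 <= g y)%E by rewrite lee_fin sqr_ge0.
have gi : Pr.-integrable setT (g \o U).
  exact: (integrable_law (quantile_rv_law hU) (integrable_second_moment Q2 c)).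
have gE : (\int[Pr]_w g (U w) = v%:E)%E.
  rewrite -vE; symmetry.
  rewrite -(integral_law (quantile_rv_law hU)) //.
  exact: integrable_second_moment.
have part V : measurable V ->
    (\int[Pr]_w ((g \o U) \_ (B @^-1` V)) w = Pr (B @^-1` V) * v%:E)%E.
  by move=> mV; rewrite -integral_mkcond (ge0_integral_indep hUB)// gE.
have parti V : Pr.-integrable setT ((g \o U) \_ (B @^-1` V)).
  by apply/(integrable_mkcond _ (mB V)); apply: integrableS gi.
(* The integrand is [g \o U] with sign [+] where the two bits agree and sign [-]
   where they differ. *)
rewrite (ae_eq_integral (fun w => ((g \o U) \_ (B @^-1` S)) w -
                                  ((g \o U) \_ (B @^-1` (~` S))) w)%E)//.
- rewrite integralB// !part// -preimage_setC probability_setC// hp.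
  by transitivity (p * v - (1 - p) * v)%:E; [|congr EFin; ring].
- apply/measurable_EFinP; apply: measurable_funM; apply: measurable_funB => //;
  exact: measurable_quantile_fun.
- by apply: emeasurable_funB;
    [have /integrableP[] := parti S|have /integrableP[] := parti (~` S)].
- apply: filterS quantile_mixX_ae => w h _.
  transitivity ((quantile_rv (X i) w - c) * (quantile_rv (X j) w - c))%:E.
    by [].
  rewrite !h mulrACA -expr2 -/(qc (U w)) !patchE.
  have [Sw|nSw] := pselect (S (B w)).
    rewrite mem_set// memNset//.
    rewrite -[point]/(0%E : \bar R).
    by rewrite sube0 /= [tnth (B w) i]Sw -signr_addb addbb mul1r.
  rewrite memNset// mem_set// -[point]/(0%E : \bar R) sub0e /=; congr EFin.
  have -> : tnth (B w) j = ~~ tnth (B w) i.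
    by move: nSw; rewrite /S /=; case: (tnth _ _); case: (tnth _ _).
  by case: (tnth _ _) => /=; rewrite ?expr0 ?expr1 ?mul1r ?mulN1r ?mulr1.
Qed.

End quantile_of_uniform.

Theorem corollary3 (R : realType) (G : R -> R) (hG : concordance_inducing G)
  (d : nat) (hd : (0 < d)%N)
  (P : 'M[R]_d) (hP : bern_half_corr P)
  (alpha : 'I_(2 ^ d.-1) -> R)
  (halpha0 : forall l, 0 <= alpha l)
  (halpha1 : \sum_l alpha l = 1)
  (hrep : P = \sum_l alpha l *: rho_pi R l)
  (disp : measure_display) (T : measurableType disp) (Pr : probability T R)
  (L : T -> 'I_(2 ^ d.-1)) (B : {RV Pr >-> d.-tuple bool})
  (hB : two_stage_draw alpha L B)
  (U : {RV Pr >-> R}) (hU : uniform01 U) (hUB : independent_RV U B) :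
  kappa_attained_by G P (mixX_RV B U).
Proof.
have [Q [QG nd [c sym] Q2]] := hG.
split=> [j|i j]; first exact: continuous_dist_fun_mixX.
have e k :
    (fun w => quantile G (dist_fun (mixX_RV B U k) (mixX_RV B U k w))) =
    quantile_rv QG (mixX_RV B U k).
  by apply/funext => w; rewrite dist_fun_mixX.
have cov k m := covariance_quantile_mixX QG sym Q2 hU hUB
  (two_stage_draw_agree hd hB k m).
have diag k :
    \sum_l alpha l * (tnth (bvec l) k == tnth (bvec l) k)%:R = 1.
  by rewrite -[RHS]halpha1; apply: eq_bigr => l _; rewrite eqxx mulr1.
rewrite /kappa !e /pearson /variance !cov !diag /=.
set v := fine _.
have v0 : 0 < v.
  have v0 := second_moment_gt0 Q2 c nd.
  rewrite fine_gt0// v0 ltey_eq (integrable_fin_num measurableT)//.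
  exact: integrable_second_moment.
have -> : v * (2 * 1 - 1) * (v * (2 * 1 - 1)) = v ^+ 2 by ring.
rewrite sqrtr_sqr gtr0_norm// mulrAC divff ?gt_eqF// mul1r.
rewrite hrep summxE -[X in _ - X]halpha1 mulr_sumr -sumrB.
by apply: eq_bigr => l _; rewrite mxE rho_piE; ring.
Qed.
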